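(* Let $s\geq 2$ be an integer and let $G$ be a connected graph of order $n>s^3+s^2-2s+1$ with $m$ edges. Suppose that the independence number of $G$ satisfies $\alpha(G)\leq s$. Let $t(G)$ denote the number of triangles in $G$. Then: (i) $\lambda_2(D(G))<3s^3\cdot\dfrac{t(G)}{m}$. (ii) If $s=2$, then $\lambda_2(D(G))<t(G)$.
   Context: All graphs are finite, simple, undirected and connected; the order of a graph is its number of vertices. For a connected graph $G$ with vertex set $\{v_1,\dots,v_n\}$, the distance $d_G(v_i,v_j)$ is the length of a shortest path from $v_i$ to $v_j$, and the distance matrix $D(G)$ is the real symmetric $n\times n$ matrix whose $(i,j)$-entry is $d_G(v_i,v_j)$. Its eigenvalues, with multiplicity, are written $\lambda_1(D(G))\geq\lambda_2(D(G))\geq\cdots\geq\lambda_n(D(G))$. The independence number $\alpha(G)$ is the maximum size of a set of pairwise nonadjacent vertices of $G$. *)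

(* Defs.v *)
(* A finite simple graph is a symmetric irreflexive relation
   [e : rel V] on a finite type [V]; its order is [#|V|]. *)
From mathcomp Require Import all_boot all_order all_algebra.
From mathcomp Require Import polyrcf.
From mathcomp Require Import reals.

Set Implicit Arguments.
Unset Strict Implicit.
Unset Printing Implicit Defensive.

Import Order.TTheory GRing.Theory Num.Theory.

Local Open Scope ring_scope.

Section Graph.
Variables (V : finType) (e : rel V).

Definition simple_graph : Prop := symmetric e /\ irreflexive e.

Definition connected_graph : Prop := forall x y : V, connect e x y.

Definition edges : {set {set V}} :=
  [set E : {set V} | [exists x, exists y, e x y && (E == [set x; y])]].

Definition triangles : {set {set V}} :=
  [set A : {set V} |
    (#|A| == 3) && [forall x in A, forall y in A, (x != y) ==> e x y]].

Definition independent (A : {set V}) : bool :=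
  [forall x in A, forall y in A, ~~ e x y].

Definition independence_number : nat :=
  \max_(A : {set V} | independent A) #|A|.

(* There is a path (no repeated vertex) with exactly [k] edges. *)
Definition has_path_of_length (x y : V) (k : nat) : bool :=
  [exists p : k.-tuple V, [&& path e x p, uniq (x :: p) & last x p == y]].

(* Paths have fewer than [#|V|] edges, so searching the lengths 0, ..., #|V|-1
   suffices; the junk value is [#|V|] when [x] and [y] are not connected. *)
Definition distance (x y : V) : nat :=
  find (has_path_of_length x y) (iota 0 #|V|).

Definition distance_matrix (R : realType) : 'M[R]_#|V| :=
  \matrix_(i, j) (distance (enum_val i) (enum_val j))%:R.

End Graph.

Section Eigenvalues.
Variables (R : realType) (n : nat).

(* The real eigenvalues, each repeated according to its multiplicity as a root
   of the characteristic polynomial, in nonincreasing order.  For a symmetric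
   real matrix these are all [n] eigenvalues. *)
Definition eigenvalues (A : 'M[R]_n) : seq R :=
  let p := char_poly A in
  sort >=%R (flatten [seq nseq (mup x p) x | x <- rootsR p]).

(* Indices start at 1; [lambda k A] is meaningful for [0 < k <= n]. *)
Definition lambda (k : nat) (A : 'M[R]_n) : R := (eigenvalues A)`_k.-1.

End Eigenvalues.

(* Main.v *)
Require Import Defs.
From mathcomp Require Import all_boot all_order all_algebra.
From mathcomp Require Import polyrcf.
From mathcomp Require Import reals.
From mathcomp Require Import complex zify ring.

(** Write [n] for the order, [m] for the number of edges and [t] for the number of
    triangles.  Both parts compare [lambda 2] and [t] with the integer
    [(s - 1) * (n - 1) - s].

    Upper bound on [lambda 2].  If some vertex were at distance [2 * s] from [x],
    vertices at the distances [0, 2, ..., 2 * s] from [x] would be [s + 1]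
    independent vertices; so distances lie in [0, 2 * s - 1] ([distance_lt]).
    Two orthonormal eigenvectors for the two largest eigenvalues span a nonzero
    vector [z] with zero coordinate sum, and the form of the distance matrix [D]
    is at least [lambda 2 * |z|^2] there.  As [z] is killed by the all-ones matrix
    [J], the form of [D] at [z] is that of [D - s J], whose diagonal entries are
    [- s] and whose other entries have absolute value at most [s - 1].  Hence
    [lambda 2 <= (s - 1) * (n - 1) - s] ([lambda2_distance_le]).  The spectral
    theorem, which also equates algebraic multiplicities with the numbers of
    eigenvectors, is used over the complex numbers.

    Lower bound on [t].  By Turan's theorem for the complement, a set of [w]
    vertices spans at least [w * (w - s) / (2 * s)] edges ([adjacencies_ge]).
    Applied to all neighbourhoods, and then to the whole vertex set, with the
    Cauchy-Schwarz inequality for the degrees, it yields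
    [m * (n - s - s ^ 2) <= 3 * s ^ 2 * t] ([triangles_ge]).  The hypothesis on [n]
    says exactly that [(s - 1) * (n - 1) - s < s * (n - s - s ^ 2)], which gives (i).

    For [s = 2] the factor [3 * s ^ 3] is [24], so (ii) follows from the same bound
    when [m >= 24].  Otherwise Turan's bound on [m] forces [n = 10]; some vertex then
    has degree at most [4], and its five or more non-neighbours, which form a clique,
    already contain [10] triangles, more than [(s - 1) * (n - 1) - s = 7]. *)

Set Implicit Arguments.
Unset Strict Implicit.
Unset Printing Implicit Defensive.

Import Order.TTheory GRing.Theory Num.Theory.

Local Open Scope nat_scope.

(** * Edges and triangles in graphs with small independence number *)

Section Combinatorics.
Variables (V : finType) (e : rel V).
Hypothesis e_simple : simple_graph e.

Let e_sym : symmetric e. Proof. by case: e_simple. Qed.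
Let e_irr : irreflexive e. Proof. by case: e_simple. Qed.

(** The open neighbourhood of [x]; its cardinal is the degree of [x]. *)
Definition neighbours (x : V) : {set V} := [set y | e x y].

(** Ordered adjacent pairs inside [W], that is, twice the number of edges of
    the subgraph induced on [W]. *)
Definition adjacencies (W : {set V}) : nat :=
  \sum_(x in W) \sum_(y in W) (e x y : nat).

Lemma card_independent (A : {set V}) :
  independent e A -> #|A| <= independence_number e.
Proof.
move=> indA; rewrite /independence_number.
exact: (@leq_bigmax_cond _ (independent e) (fun A : {set V} => #|A|)).
Qed.

Lemma adjacencies_setU (A B : {set V}) : [disjoint A & B] ->
  adjacencies (A :|: B) =
  adjacencies A + adjacencies B + 2 * \sum_(x in B) \sum_(y in A) (e x y : nat).
Proof.
move=> dAB.
have splitU (F : V -> nat) :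
    \sum_(y in A :|: B) F y = \sum_(y in A) F y + \sum_(y in B) F y.
  by rewrite -bigU //=; apply: eq_bigl => y; rewrite !inE.
have splitUU (D : {set V}) : \sum_(x in D) \sum_(y in A :|: B) (e x y : nat) =
    \sum_(x in D) \sum_(y in A) (e x y : nat) +
    \sum_(x in D) \sum_(y in B) (e x y : nat).
  by rewrite -big_split; apply: eq_bigr => x _; apply: splitU.
have swap : \sum_(x in A) \sum_(y in B) (e x y : nat) =
    \sum_(x in B) \sum_(y in A) (e x y : nat).
  by rewrite exchange_big; apply: eq_bigr => x _; apply: eq_bigr => y _; rewrite e_sym.
rewrite /adjacencies splitU !splitUU swap; lia.
Qed.

(** Turan's bound in complementary form: peel off a maximal independent subset,
    which every remaining vertex has a neighbour in. *)
Lemma adjacencies_ge (s : nat) (W : {set V}) :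
  independence_number e <= s ->
  #|W| ^ 2 <= s * adjacencies W + s * #|W|.
Proof.
move=> le_s; have [k] := ubnP #|W|; elim: k W => // k IH W leWk.
have [->|/set0Pn [w wW]] := eqVneq W set0; first by rewrite cards0.
pose P (I : {set V}) := (I \subset W) && independent e I.
have Pw : P [set w].
  rewrite /P sub1set wW; apply/forall_inP => x /set1P ->.
  by apply/forall_inP => y /set1P ->; rewrite e_irr.
have [I /maxsetP [/andP [sIW indI] maxI] swI] := maxset_exists Pw.
have I_gt0 : 0 < #|I| by rewrite (leq_trans _ (subset_leq_card swI)) ?cards1.
have leIs : #|I| <= s := leq_trans (card_independent indI) le_s.
have dIW : [disjoint I & W :\: I].
  by rewrite disjoints_subset; apply/subsetP=> x; rewrite !inE => ->.
have defW : W = I :|: (W :\: I).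
  by rewrite setDE setUIr setUCr setIT; apply/esym/setUidPr.
have cW : #|W| = #|I| + #|W :\: I| by rewrite -(cardsID I W) (setIidPr sIW).
have /IH IHW : #|W :\: I| < k by lia.
have dom : #|W :\: I| <= \sum_(x in W :\: I) \sum_(y in I) (e x y : nat).
  rewrite -sum1_card; apply: leq_sum => x; rewrite inE => /andP [xI xW].
  rewrite lt0n sum_nat_eq0; apply: contraNN xI => /forall_inP no_nbr.
  have no_adj y : y \in I -> e x y = false by move=> /no_nbr; case: (e x y).
  have <- : x |: I = I; last by rewrite setU11.
  apply: maxI (subsetUr _ _); rewrite /P subUset sub1set xW sIW /=.
  apply/forall_inP => y /setU1P yI; apply/forall_inP => z /setU1P zI.
  case: yI zI => [->|yI] [->|zI]; rewrite ?e_irr ?no_adj //.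
    by rewrite e_sym no_adj.
  by have /forall_inP/(_ y yI)/forall_inP/(_ z zI) := indI.
have eW : adjacencies W = adjacencies I + adjacencies (W :\: I) +
    2 * \sum_(x in W :\: I) \sum_(y in I) (e x y : nat).
  by rewrite {1}defW adjacencies_setU.
nia.
Qed.

Lemma sum_card_containing (E : {set {set V}}) (k : nat) :
  (forall A, A \in E -> #|A| = k) ->
  \sum_x #|[set A in E | x \in A]| = k * #|E|.
Proof.
move=> cardE.
under eq_bigr do rewrite -sum1dep_card.
under eq_bigr do rewrite big_mkcondr.
rewrite exchange_big /= mulnC -sum_nat_const; apply: eq_bigr => A AE.
by rewrite -big_mkcond sum1_card cardE.
Qed.

Lemma card_edge (E : {set V}) : E \in edges e -> #|E| = 2.
Proof.
rewrite inE => /existsP [x /existsP [y /andP [exy /eqP ->]]].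
by rewrite cards2; case: eqVneq exy => // ->; rewrite e_irr.
Qed.

Lemma card_neighbours (x : V) :
  #|neighbours x| = #|[set E in edges e | x \in E]|.
Proof.
have inj : {in neighbours x &, injective (fun y => [set x; y])}.
  move=> y z; rewrite !inE => exy exz /setP /(_ y).
  rewrite !inE eqxx orbT => /esym /orP [] /eqP // yx.
  by rewrite yx e_irr in exy.
rewrite -(card_in_imset inj); apply: eq_card => E; rewrite !inE.
apply/imsetP/andP => [[y]|[/existsP [y /existsP [z /andP [eyz /eqP ->]]]]].
  rewrite inE => exy ->; split; last by rewrite !inE eqxx.
  by apply/existsP; exists x; apply/existsP; exists y; rewrite exy eqxx.
rewrite !inE => /orP [] /eqP ->; first by exists z; rewrite ?inE.
by exists y; rewrite ?inE 1?e_sym // setUC.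
Qed.

Lemma sum_degrees : \sum_x #|neighbours x| = 2 * #|edges e|.
Proof.
under eq_bigr do rewrite card_neighbours.
exact: sum_card_containing card_edge.
Qed.

Lemma adjacencies_setT : adjacencies setT = 2 * #|edges e|.
Proof.
rewrite -sum_degrees /adjacencies big_mkcond; apply: eq_bigr => x _.
rewrite inE -sum1_card big_mkcond [RHS]big_mkcond; apply: eq_bigr => y _.
by rewrite !inE; case: (e x y).
Qed.

Lemma adjacencies_neighbours_le (x : V) :
  adjacencies (neighbours x) <= 2 * #|[set A in triangles e | x \in A]|.
Proof.
set T := [set A in _ | _].
have cardT A : A \in T ->
    \sum_y \sum_z ((y \in A :\ x) && (z \in A :\ x :\ y) : nat) = 2.
  rewrite !inE => /andP [/andP [/eqP cA _] xA].
  have cAx : #|A :\ x| = 2 by move: (cardsD1 x A); rewrite cA xA => -[].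
  rewrite -[RHS]muln1 -{1}cAx -sum_nat_const [RHS]big_mkcond.
  apply: eq_bigr => y _; case: ifP => [yA|_] /=; last by rewrite big1.
  rewrite -big_mkcond sum1_card.
  by move: (cardsD1 y (A :\ x)); rewrite cAx yA => -[].
rewrite mulnC -sum_nat_const -(eq_bigr _ cardT) exchange_big /adjacencies big_mkcond /=.
apply: leq_sum => y _; case: ifP => // yN; rewrite exchange_big big_mkcond /=.
apply: leq_sum => z _; case: ifP => // zN; case: (boolP (e y z)) => //= eyz.
move: yN zN; rewrite !inE => exy exz.
have neq u v : e u v -> u != v.
  by move=> euv; apply: contraTneq euv => ->; rewrite e_irr.
have [nxy nxz nyz] : [/\ x != y, x != z & y != z] by split; apply: neq.
have xyzT : [set x; y; z] \in T.
  rewrite !inE eqxx /= andbT; apply/andP; split.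
    by rewrite -setUA cardsU1 !inE negb_or nxy nxz cards2 nyz.
  apply/forall_inP => u; rewrite !inE => Hu; apply/forall_inP => v; rewrite !inE => Hv.
  apply/implyP; case/orP: Hu => [/orP []|] /eqP ->; case/orP: Hv => [/orP []|] /eqP ->;
    by rewrite ?eqxx ?exy ?exz ?eyz // e_sym ?exy ?exz ?eyz.
rewrite (bigD1 [set x; y; z]) //= !inE !eqxx !orbT /=.
by rewrite (eq_sym y x) (eq_sym z x) (eq_sym z y) nxy nxz nyz.
Qed.

Lemma card_triangle (A : {set V}) : A \in triangles e -> #|A| = 3.
Proof. by rewrite inE => /andP [/eqP]. Qed.

Lemma sum_adjacencies_neighbours_le :
  \sum_x adjacencies (neighbours x) <= 6 * #|triangles e|.
Proof.
apply: (@leq_trans (\sum_x 2 * #|[set A in triangles e | x \in A]|)).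
  by apply: leq_sum => x _; apply: adjacencies_neighbours_le.
by rewrite -big_distrr /= (sum_card_containing card_triangle) mulnA.
Qed.

(** This is [m * (n - s - s ^ 2) <= 3 * s ^ 2 * t] without subtraction.  Summing
    the Turan bound over all neighbourhoods bounds [6 * s * t] below by the sum of
    [d ^ 2 - s * d] over the degrees [d]; this sum is at least
    [(2 * m) ^ 2 / n - 2 * s * m] by Cauchy-Schwarz, and the Turan bound on the
    whole vertex set gives [2 * m / n >= n / s - 1]. *)
Lemma triangles_ge (s : nat) : independence_number e <= s ->
  #|edges e| * #|V| <= 3 * s ^ 2 * #|triangles e| + #|edges e| * (s + s ^ 2).
Proof.
move=> le_s; set m := #|edges e|; set t := #|triangles e|; set n := #|V|.
have n2 : n ^ 2 <= s * (2 * m) + s * n.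
  by rewrite -adjacencies_setT /n -cardsT; apply: adjacencies_ge.
have sumd2 : \sum_x #|neighbours x| ^ 2 <= 6 * s * t + 2 * s * m.
  have -> : 6 * s * t + 2 * s * m = s * (6 * t) + s * (2 * m) by lia.
  rewrite -sum_degrees.
  have le_t := leq_mul (leqnn s) sum_adjacencies_neighbours_le.
  apply: leq_trans (leq_add le_t (leqnn _)).
  rewrite !big_distrr -big_split; apply: leq_sum => x _; exact: adjacencies_ge.
have CS : (2 * m) ^ 2 <= n * \sum_x #|neighbours x| ^ 2.
  rewrite -sum_degrees.
  rewrite expnS expn1 -(leq_pmul2l (isT : 0 < 2)).
  set F := fun x => #|neighbours x|.
  have -> : 2 * (n * \sum_x F x ^ 2) = \sum_x \sum_y (F x ^ 2 + F y ^ 2).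
    under [RHS]eq_bigr do rewrite big_split /= sum_nat_const.
    by rewrite big_split /= -big_distrr /= sum_nat_const mul2n addnn.
  rewrite big_distrl big_distrr /=; apply: leq_sum => x _.
  rewrite !big_distrr /=; apply: leq_sum => y _; exact: nat_Cauchy.
have [->|m0] := posnP m; first by [].
have {}sumd2 : (2 * m) ^ 2 <= n * (6 * s * t + 2 * s * m).
  exact: leq_trans CS (leq_mul (leqnn _) sumd2).
have n0 : 0 < n.
  rewrite lt0n; apply: contraTneq m0 => n0.
  by move: n2 sumd2; rewrite n0 => _; nia.
rewrite -(leq_pmul2r n0).
have := leq_mul (leqnn m) n2.
have := leq_mul (leqnn s) sumd2.
nia.
Qed.

(** When no three vertices are independent, the vertices that are neither [x] nor
    adjacent to it form a clique, and every triple of them is a triangle. *)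
Lemma triangles_ge_nonneighbours (x : V) : independence_number e <= 2 ->
  'C(#|V| - #|neighbours x|.+1, 3) <= #|triangles e|.
Proof.
move=> le2; pose W := ~: (x |: neighbours x).
have cW : #|W| = #|V| - #|neighbours x|.+1.
  rewrite -(cardsC (x |: neighbours x)) cardsU1 inE e_irr /= add1n.
  by rewrite -/W addKn.
rewrite -cW -cards_draws; apply: subset_leq_card; apply/subsetP => A.
rewrite !inE => /andP [/subsetP sAW ->] /=.
apply/forall_inP => y /sAW yW; apply/forall_inP => z /sAW zW; apply/implyP => yz.
move: yW zW; rewrite !inE !negb_or => /andP [yx xy] /andP [zx xz].
apply: contraTT (leqnn 3) => nyz; rewrite -ltnNge ltnS.
have -> : 3 = #|[set x; y; z]|.
  by rewrite -setUA cardsU1 !inE negb_or (eq_sym x) yx (eq_sym x) zx cards2 yz.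
apply: leq_trans le2; apply: card_independent.
apply/forall_inP => u; rewrite !inE => Hu; apply/forall_inP => v; rewrite !inE => Hv.
by case/orP: Hu => [/orP []|] /eqP ->; case/orP: Hv => [/orP []|] /eqP ->;
  rewrite ?e_irr // e_sym ?xy ?xz ?nyz // e_sym.
Qed.

(** * Distances *)

Lemma distance_path_le (x : V) (p : seq V) :
  path e x p -> distance e x (last x p) <= size p.
Proof.
case/shortenP => q xq uq sub.
have le_qp : size q <= size p by apply: uniq_leq_size => //; case/andP: uq.
apply: leq_trans le_qp; rewrite leqNgt; apply/negP => lt_q.
have q_lt : size q < #|V|.
  by rewrite -[(size q).+1]/(size (x :: q)) -(card_uniqP uq) max_card.
have := before_find 0 lt_q.
rewrite nth_iota // add0n => /negbT /negP; apply; apply/existsP; exists (in_tuple q).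
by rewrite xq uq eqxx.
Qed.

Hypothesis e_connected : connected_graph e.

Lemma distance_pathP (x y : V) :
  exists p, [/\ path e x p, last x p = y & size p = distance e x y].
Proof.
have /connectP [p xp yp] := e_connected x y.
have le_d := distance_path_le xp.
have : has (has_path_of_length e x y) (iota 0 #|V|).
  case/shortenP: xp yp => q xq uq _ yq.
  have q_lt : size q < #|V|.
    by rewrite -[(size q).+1]/(size (x :: q)) -(card_uniqP uq) max_card.
  apply/hasP; exists (size q); first by rewrite mem_iota.
  rewrite /has_path_of_length; apply/existsP; exists (in_tuple q).
  by rewrite xq uq -yq eqxx.
move=> has_d; have := nth_find 0 has_d; rewrite -/(distance e x y).
rewrite /has_path_of_length nth_iota; last first.
  by rewrite -[X in _ < X](size_iota 0) -has_find.
case/existsP => q /and3P [xq _ /eqP yq].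
by exists q; rewrite size_tuple.
Qed.

Lemma distance_refl (x : V) : distance e x x = 0.
Proof. by apply/eqP; rewrite -leqn0; exact: (@distance_path_le x [::]). Qed.

Lemma distance_gt0 (x y : V) : x != y -> 0 < distance e x y.
Proof.
have [[|z p] [_ /= xy <-]] // := distance_pathP x y.
by rewrite xy eqxx.
Qed.

Lemma distance_sym (x y : V) : distance e x y = distance e y x.
Proof.
suff le_d u v : distance e v u <= distance e u v by apply/eqP; rewrite eqn_leq !le_d.
have [p [up lp <-]] := distance_pathP u v.
have lr : last v (rev (belast u p)) = u.
  by case: p lp {up} => [|z p] //= _; rewrite rev_cons last_rcons.
have := @distance_path_le v (rev (belast u p)).
rewrite lr size_rev size_belast; apply; rewrite -lp rev_path.
by rewrite (eq_path (e' := e)) // => a b; apply: e_sym.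
Qed.

Lemma distance_adjacent_le (x y z : V) : e y z -> distance e x z <= (distance e x y).+1.
Proof.
have [p [xp yp <-]] := distance_pathP x y => eyz.
rewrite -(size_rcons p z) -{1}(last_rcons x p z); apply: distance_path_le.
by rewrite rcons_path xp yp.
Qed.

(** Along a path from [x] to [y] the distance from [x] grows by at most one at each
    step, so it takes every intermediate value. *)
Lemma distance_onto (x y : V) (k : nat) :
  k <= distance e x y -> exists z, distance e x z = k.
Proof.
have /connectP [p] := e_connected x y.
elim/last_ind: p y => [|p z IH] y /=.
  move=> _ ->; rewrite distance_refl leqn0 => /eqP ->.
  by exists x; rewrite distance_refl.
rewrite rcons_path last_rcons => /andP [xp ez] -> le_k.
have [le_k'|lt_k] := leqP k (distance e x (last x p)); first exact: IH xp _ le_k'.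
exists z; apply/eqP; rewrite eqn_leq le_k andbT.
exact: leq_trans (distance_adjacent_le x ez) lt_k.
Qed.

(** Adjacent vertices have distances from [x] that differ by at most one, so
    vertices at pairwise distinct even distances are independent. *)
Lemma distance_lt (s : nat) (x y : V) : independence_number e <= s ->
  distance e x y < 2 * s.
Proof.
move=> le_s; rewrite ltnNge; apply/negP => le_d.
have Z (i : 'I_s.+1) : exists z, distance e x z == 2 * i.
  have [|z <-] := @distance_onto x y (2 * i); last by exists z.
  by apply: leq_trans le_d; rewrite leq_mul2l /= -ltnS.
pose z i := xchoose (Z i).
have zE i : distance e x (z i) = 2 * i by apply/eqP/(xchooseP (Z i)).
have injz : injective z.
  by move=> i j /(congr1 (distance e x)); rewrite !zE => ij; apply: val_inj => /=; lia.
have : independent e (z @: setT).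
  apply/forall_inP => _ /imsetP [i _ ->]; apply/forall_inP => _ /imsetP [j _ ->].
  apply/negP => eij; have := distance_adjacent_le x eij.
  rewrite e_sym in eij; have := distance_adjacent_le x eij.
  rewrite !zE => ? ?; have ij : i = j by apply: val_inj => /=; lia.
  by rewrite ij e_irr in eij.
move/card_independent; rewrite card_imset // cardsT card_ord.
by move=> /leq_trans /(_ le_s); rewrite ltnn.
Qed.

End Combinatorics.

Local Open Scope ring_scope.
Local Open Scope sesquilinear_scope.
Local Open Scope complex_scope.

(** * Hermitian matrices *)

Lemma char_poly_similar (F : fieldType) (n : nat) (P A B : 'M[F]_n) :
  P \in unitmx -> P *m A = B *m P -> char_poly A = char_poly B.
Proof.
rewrite unitmxE unitfE => P0 PA; pose Q := map_mx polyC P.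
have Q0 : \det Q != 0 by rewrite det_map_mx polyC_eq0.
apply: (mulfI Q0); rewrite /char_poly -det_mulmx mulrC -det_mulmx.
by rewrite /char_poly_mx mulmxBl mulmxBr -!map_mxM PA scalar_mxC.
Qed.

Section HermitianForm.
Variable C : numClosedFieldType.

Lemma mulmx_adjoint (n : nat) (z : 'rV[C]_n) :
  (z *m z ^t*) 0 0 = \sum_i `|z 0 i| ^+ 2.
Proof. by rewrite mxE; apply: eq_bigr => i _; rewrite !mxE normCK. Qed.

(** The constant [n - 1] comes from [2 |z_i| |z_j| <= |z_i|^2 + |z_j|^2], each index
    occurring in [n - 1] unordered pairs. *)
Lemma offdiagonal_form_le (n : nat) (B : 'M[C]_n) (b : C) (z : 'rV[C]_n) :
  (forall i, B i i = 0) -> (forall i j, i != j -> `|B i j| <= b) ->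
  `|(z *m B *m z ^t*) 0 0| <= b * n.-1%:R * (z *m z ^t*) 0 0.
Proof.
move=> B0 Bb; rewrite mulmx_adjoint.
have -> : (z *m B *m z ^t*) 0 0 =
    \sum_i \sum_(j | j != i) z 0 j * B j i * (z 0 i)^*.
  rewrite mxE; apply: eq_bigr => i _; rewrite !mxE mulr_suml (bigD1 i) //=.
  by rewrite B0 mulr0 mul0r add0r.
apply: le_trans (ler_norm_sum _ _ _) _.
pose F i j : C := b * ((`|z 0 i| ^+ 2 + `|z 0 j| ^+ 2) / 2).
apply: (@le_trans _ _ (\sum_i \sum_(j | j != i) F i j)).
  apply: ler_sum => i _; apply: le_trans (ler_norm_sum _ _ _) _.
  apply: ler_sum => j ji; rewrite !normrM norm_conjC /F.
  have b0 : 0 <= b := le_trans (normr_ge0 _) (Bb _ _ ji).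
  rewrite mulrAC mulrC ler_pM ?mulr_ge0 ?Bb // mulrC.
  have real_norm (w : C) : `|w| \is Num.real by apply: normr_real.
  by have [] := real_leif_mean_square (real_norm (z 0 i)) (real_norm (z 0 j)).
pose N i : C := `|z 0 i| ^+ 2.
have inner i : \sum_(j | j != i) F i j =
    b * ((N i *+ n.-1 + \sum_(j | j != i) N j) / 2).
  rewrite -mulr_sumr -mulr_suml big_split /= sumr_const.
  by congr (_ * ((_ *+ _ + _) / _)); rewrite cardC1 card_ord.
rewrite (eq_bigr _ (fun i _ => inner i)) -mulr_sumr -mulr_suml big_split /= sumrMnl.
have -> : \sum_i \sum_(j | j != i) N j = \sum_i N i *+ n.-1.
  rewrite (exchange_big_dep predT) //=; apply: eq_bigr => j _.
  rewrite (eq_bigl (fun i => i != j)) => [|i]; last by rewrite eq_sym.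
  by rewrite sumr_const cardC1 card_ord.
rewrite sumrMnl -mulr2n -[_ *+ 2]mulr_natr mulfK ?pnatr_eq0 //.
by rewrite -mulrA mulr_natl.
Qed.

Lemma hermitian_form_real (n : nat) (A : 'M[C]_n) (z : 'rV[C]_n) :
  A ^t* = A -> (z *m A *m z ^t*) 0 0 \is Num.real.
Proof.
move=> hermA; set M := _ *m _; apply/CrealP.
suff ME : M ^t* = M by move/matrixP/(_ 0 0): ME; rewrite [LHS]mxE mxE.
by rewrite /M !trmx_mul !map_mxM trmxCK hermA mulmxA.
Qed.

(** The spectral theorem, with the multiplicity of each root of the characteristic
    polynomial as a count of eigenvectors: the rows of [P] are the eigenvectors. *)
Lemma normal_spectral (n : nat) (A : 'M[C]_n) : A \is normalmx ->
  exists P : 'M[C]_n, exists d : 'rV[C]_n,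
    [/\ P \is unitarymx, P *m A = diag_mx d *m P
      & forall x, mup x (char_poly A) = #|[set i | d 0 i == x]| ].
Proof.
move=> /orthomx_spectralP; set P := spectralmx A; set d := spectral_diag A => AE.
have Pu : P \in unitmx := spectral_unit A.
have PA : P *m A = diag_mx d *m P by rewrite AE !mulmxA mulmxV // mul1mx.
exists P, d; split=> [||x] //; first exact: spectral_unitarymx.
rewrite (char_poly_similar Pu PA) char_poly_trig ?diag_mx_is_trig //.
rewrite (eq_bigr (fun i => 'X - (d 0 i)%:P)); last first.
  by move=> i _; rewrite mxE eqxx mulr1n.
rewrite -(big_map (fun i => d 0 i) predT (fun y => 'X - y%:P)).
rewrite mu_prod_XsubC count_map -sum1_count -sum1dep_card.
exact: eq_bigl.
Qed.

(** Two orthonormal eigenvectors span a nonzero vector [z] with zero coordinate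
    sum.  Here [x] and [y] are the squared absolute values of its coefficients on the
    two eigenvectors. *)
Lemma eigenvectors_combination (n : nat) (A P : 'M[C]_n) (d : 'rV[C]_n) (i j : 'I_n) :
  P \is unitarymx -> P *m A = diag_mx d *m P -> i != j ->
  exists z : 'rV[C]_n, exists x : C, exists y : C,
    [/\ 0 <= x, 0 <= y, 0 < x + y & \sum_k z 0 k = 0] /\
    (z *m z ^t*) 0 0 = x + y /\
    (z *m A *m z ^t*) 0 0 = d 0 i * x + d 0 j * y.
Proof.
move=> uP PA ij; pose p := row i P; pose q := row j P.
have orth k l : row k P *m (row l P) ^t* = (k == l)%:R%:M.
  move/unitarymxP/matrixP/(_ k l): uP; rewrite !mxE => <-.
  apply/matrixP => u v; rewrite !ord1 !mxE mulr1n.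
  by apply: eq_bigr => w _; rewrite !mxE.
have rowA k : row k P *m A = d 0 k *: row k P.
  by rewrite -row_mul PA; apply/rowP => l; rewrite mul_diag_mx !mxE.
have [al [be [ab0 sum0]]] : exists al, exists be : C,
    (al != 0) || (be != 0) /\ \sum_k (al *: p + be *: q) 0 k = 0.
  have sumE al be : \sum_k (al *: p + be *: q) 0 k =
      al * (\sum_k p 0 k) + be * (\sum_k q 0 k).
    by rewrite !mulr_sumr -big_split; apply: eq_bigr => k _; rewrite !mxE.
  (* The combination with coefficients [\sum q] and [- \sum p] works, unless it
     may be trivial; then [p] itself has zero sum. *)
  have [p0|p0] := eqVneq (\sum_k p 0 k) 0.
    by exists 1, 0; rewrite oner_eq0 sumE p0 mulr0 mul0r addr0.
  exists (\sum_k q 0 k), (- \sum_k p 0 k); rewrite oppr_eq0 p0 orbT; split=> //.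
  by rewrite sumE mulrC mulNr subrr.
have adjE : (al *: p + be *: q) ^t* = al^* *: p ^t* + be^* *: q ^t*.
  by rewrite linearD !linearZ map_mxD !map_mxZ.
have formE x y : ((x *: p + y *: q) *m (al *: p + be *: q) ^t*) 0 0 =
    x * al^* + y * be^*.
  rewrite adjE mulmxDl !mulmxDr -!scalemxAl -!scalemxAr.
  rewrite !orth (eq_sym j) (negPf ij) !eqxx !mxE eqxx.
  by rewrite !mulr1n !mulr0n !mulr1 !mulr0 add0r addr0.
exists (al *: p + be *: q), (al * al^*), (be * be^*).
rewrite formE mulmxDl -!scalemxAl !rowA !scalerA formE.
rewrite !(mulrC _ (d 0 _)) -!mulrA !mul_conjC_ge0; split=> //; split=> //.
rewrite lt0r addr_ge0 ?mul_conjC_ge0 // andbT paddr_eq0 ?mul_conjC_ge0 //.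
by rewrite !mul_conjC_eq0 negb_and.
Qed.

End HermitianForm.

Lemma count_flatten_nseq_le (T : eqType) (r : seq T) (mu : T -> nat) (x : T) :
  uniq r -> (count_mem x (flatten [seq nseq (mu y) y | y <- r]) <= mu x)%N.
Proof.
elim: r => //= y r IH /andP [yr /IH {}IH].
rewrite count_cat count_nseq /=; case: eqVneq => [yx|_]; last by rewrite mul0n.
rewrite mul1n -yx (_ : count_mem y _ = 0%N) ?addn0 //; apply/count_memPn.
apply: contra yr => /flattenP [_ /mapP [w wr ->]].
by rewrite mem_nseq => /andP [_ /eqP ->].
Qed.

(** * The second largest eigenvalue *)

Section Lambda2.
Variable R : realType.
Let C := R[i].

Lemma count_eigenvalues_le (n : nat) (A : 'M[R]_n) (x : R) :
  (count_mem x (eigenvalues A) <= mup x (char_poly A))%N.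
Proof.
rewrite /eigenvalues (permP (permEl (perm_sort _ _))).
by apply: count_flatten_nseq_le; apply: uniq_roots.
Qed.

Lemma eigenvalues_sorted (n : nat) (A : 'M[R]_n) : sorted >=%R (eigenvalues A).
Proof. by apply: sort_sorted => x y; rewrite orbC le_total. Qed.

Lemma mup_map_complex (p : {poly R}) (x : R) : p != 0 ->
  mup x%:C (map_poly (real_complex R) p) = mup x p.
Proof.
move=> p0; have pC0 : map_poly (real_complex R) p != 0 by rewrite map_poly_eq0.
have H k : (k <= mup x%:C (map_poly (real_complex R) p))%N = (k <= mup x p)%N.
  rewrite !mup_geq // -(dvdp_map (real_complex R)) rmorphXn /=.
  by rewrite rmorphB /= map_polyX map_polyC.
by apply/eqP; rewrite eqn_leq H leqnn -H leqnn.
Qed.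

Lemma complexify_hermitian (n : nat) (A : 'M[R]_n) : A^T = A ->
  (map_mx (real_complex R) A) ^t* = map_mx (real_complex R) A.
Proof.
move=> symA; apply/matrixP => k l; rewrite !mxE -[in A l k]symA mxE.
by apply/CrealP/complex_realP; exists (A k l).
Qed.

(** The eigenvectors of the two largest eigenvalues span a nonzero vector with zero
    coordinate sum, where the form of [A] is at least [lambda 2 A].  The hypothesis
    [0 <= c] covers the default value [0] of [lambda 2 A], taken when there are fewer
    than two eigenvalues. *)
Lemma lambda2_le (n : nat) (A : 'M[R]_n) (c : R) : A^T = A -> 0 <= c ->
  (forall z : 'rV[C]_n, \sum_i z 0 i = 0 ->
    (z *m map_mx (real_complex R) A *m z ^t*) 0 0 <= c%:C * (z *m z ^t*) 0 0) ->
  lambda 2 A <= c.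
Proof.
move=> symA c0 formA; rewrite /lambda /=.
have [szE|szE] := leqP (size (eigenvalues A)) 1; first by rewrite nth_default.
have normA : map_mx (real_complex R) A \is normalmx.
  by apply/normalmxP; rewrite complexify_hermitian.
have [P [d [uP PA cntd]]] := normal_spectral normA.
have {}cntd x : (count_mem x (eigenvalues A) <= #|[set i | d 0%R i == x%:C]|)%N.
  rewrite -cntd -map_char_poly mup_map_complex ?count_eigenvalues_le //.
  by rewrite monic_neq0 ?char_poly_monic.
have := eigenvalues_sorted A.
case: (eigenvalues A) szE cntd => [|a [|b E]] //= _ cntd /andP [ba _].
rewrite leNgt; apply/negP => cb.
(* Distinct [a] and [b] have one index each; if [a = b], this value occurs at two
   indices, because its multiplicity is at least two. *)
have [i [j [ij di dj]]] : exists i, exists j, [/\ i != j, d 0 i = a%:C & d 0 j = b%:C].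
  have [ab|ab] := eqVneq a b.
    have /card_gt1P [i [j [Hi Hj ij]]] : (1 < #|[set i | d 0%R i == b%:C]|)%N.
      by apply: leq_trans (cntd b); rewrite ab eqxx.
    exists i, j; move: Hi Hj; rewrite !inE ab => /eqP -> /eqP ->; by split.
  have /card_gt0P [i di] : (0 < #|[set i | d 0%R i == a%:C]|)%N.
    by apply: leq_trans (cntd a); rewrite eqxx.
  have /card_gt0P [j dj] : (0 < #|[set i | d 0%R i == b%:C]|)%N.
    by apply: leq_trans (cntd b); rewrite eqxx addnCA.
  move: di dj; rewrite !inE => /eqP di /eqP dj; exists i, j; split=> //.
  by apply: contra_neq ab => ij; apply: complexI; rewrite -di -dj ij.
have [z [x [y [[x0 y0 xy0 z0] [zz zAz]]]]] := eigenvectors_combination uP PA ij.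
have := formA z z0; rewrite zz zAz di dj => /le_gtF /negbT /negP; apply.
apply: (@lt_le_trans _ _ (b%:C * (x + y))); first by rewrite ltr_pM2r ?ltcR.
by rewrite mulrDr lerD // ler_wpM2r ?lecR.
Qed.

End Lambda2.

(** * Distance eigenvalues and triangles *)

(** Subtracting [s] times the all-ones matrix, invisible to vectors with zero
    coordinate sum, leaves off-diagonal entries between [1 - s] and [s - 1] and
    the diagonal [- s].  The last hypothesis makes the bound nonnegative. *)
Lemma lambda2_distance_le (R : realType) (V : finType) (e : rel V) (s : nat) :
  simple_graph e -> connected_graph e -> (independence_number e <= s)%N ->
  (s <= s.-1 * #|V|.-1)%N ->
  lambda 2 (distance_matrix e R) <= (s.-1 * #|V|.-1)%:R - s%:R.
Proof.
move=> e_simple e_conn le_s s_le.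
have symD : (distance_matrix e R)^T = distance_matrix e R.
  by apply/matrixP => k l; rewrite !mxE distance_sym.
apply: lambda2_le => // [|z z0]; first by rewrite subr_ge0 ler_nat.
set D := map_mx _ _; set N := (z *m z ^t*) 0 0.
pose B := D - s%:R *: const_mx 1 + s%:R%:M.
have zJ : z *m const_mx 1 = 0 :> 'rV_#|V|.
  apply/rowP => k; rewrite !mxE -[RHS]z0.
  by apply: eq_bigr => l _; rewrite mxE mulr1.
have formB : (z *m B *m z ^t*) 0 0 = (z *m D *m z ^t*) 0 0 + s%:R * N.
  rewrite mulmxDr mulmxBr -scalemxAr zJ scaler0 subr0 mul_mx_scalar mulmxDl mxE.
  by rewrite -scalemxAl [X in _ + X]mxE.
have realB : (z *m B *m z ^t*) 0 0 \is Num.real.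
  rewrite formB rpredD ?hermitian_form_real ?complexify_hermitian // rpredM ?realn //.
  by rewrite /N mulmx_adjoint rpred_sum // => k _; rewrite rpredX ?normr_real.
have BB : (z *m B *m z ^t*) 0 0 <= s.-1%:R * #|V|.-1%:R * N.
  apply: le_trans (real_ler_norm realB) _; apply: offdiagonal_form_le.
    by move=> k; rewrite !mxE distance_refl // eqxx rmorph_nat mulr1 sub0r addNr.
  move=> k l kl; rewrite !mxE (negPf kl) mulr0n addr0 mulr1 rmorph_nat.
  have kl' : enum_val k != enum_val l by apply: contra_neq kl; apply: enum_val_inj.
  have d0 := distance_gt0 e_conn kl'.
  have ds := distance_lt e_simple e_conn (enum_val k) (enum_val l) le_s.
  set d := distance _ _ _ in d0 ds *.
  have dB : (d%:R - s%:R : R[i]) = (d%:Z - s%:Z)%:~R by rewrite rmorphB.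
  by rewrite dB -intr_norm -[s.-1%:R]/((s.-1)%:Z%:~R) ler_int; lia.
rewrite rmorphB /= !rmorph_nat natrM mulrBl lerBrDr -formB.
exact: BB.
Qed.

Theorem theorem3 (R : realType) (V : finType) (e : rel V) (s : nat)
    (hs : (2 <= s)%N)
    (hsimple : simple_graph e)
    (hconn : connected_graph e)
    (hn : (s ^ 3 + s ^ 2 - 2 * s + 1 < #|V|)%N)
    (halpha : (independence_number e <= s)%N) :
  (lambda 2 (distance_matrix e R) <
     3 * s%:R ^+ 3 * (#|triangles e|%:R / #|edges e|%:R)) /\
  (s = 2%N -> lambda 2 (distance_matrix e R) < #|triangles e|%:R).
Proof.
have s_le : (s <= s.-1 * #|V|.-1)%N by nia.
have lam := lambda2_distance_le R hsimple hconn halpha s_le.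
have tri := triangles_ge hsimple halpha.
have edg := @adjacencies_ge _ _ hsimple _ setT halpha.
rewrite adjacencies_setT // cardsT in edg.
set m := #|edges e| in tri edg *; set t := #|triangles e| in tri *.
set n := #|V| in hn s_le lam tri edg *.
have m0 : (0 < m)%N.
  rewrite lt0n; apply: contraTneq edg => ->.
  rewrite !muln0 add0n expnS expn1 -ltnNge ltn_mul2r; nia.
have part1 : ((s.-1 * n.-1 - s) * m < 3 * s ^ 3 * t)%N.
  have sn : (s.-1 * n.-1 + s + n = s * n + 1)%N.
    by case: (s) (n) hs hn => [|p] [|q] //=; lia.
  have bound : (s.-1 * n.-1 - s + (s ^ 2 + s ^ 3) < s * n)%N by lia.
  rewrite -(ltn_add2r (m * (s ^ 2 + s ^ 3))).
  apply: (@leq_trans (m * (s * n))).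
    by rewrite [(m * (_ + _))%N]mulnC -mulnDl [ltnRHS]mulnC ltn_pmul2r.
  rewrite mulnCA; apply: leq_trans (leq_mul (leqnn s) tri) _.
  by apply: eq_leq; ring.
have lam_lt (q : R) : (s.-1 * n.-1 - s)%:R < q -> lambda 2 (distance_matrix e R) < q.
  by apply: le_lt_trans; rewrite natrB.
split=> [|s2]; apply: lam_lt.
  by rewrite mulrA ltr_pdivlMr ?ltr0n // -natrX -!natrM ltr_nat.
rewrite ltr_nat.
have [m23|m24] := ltnP m 24; last first.
  rewrite -(ltn_pmul2l (isT : 0 < 24)%N); move: part1; rewrite s2.
  by apply: leq_ltn_trans; rewrite mulnC leq_mul2l m24 orbT.
(* The hypothesis on [n] reads [9 < n], and Turan's bound [n ^ 2 <= 4 * m + 2 * n]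
   excludes [11 <= n] when [m < 24]. *)
have n10 : n = 10%N by move: hn edg; rewrite s2; nia.
have [x dx] : exists x, (#|neighbours e x| <= 4)%N.
  apply/existsP; rewrite -[X in is_true X]negbK negb_exists.
  apply/negP => /forallP deg5.
  have : (\sum_(x : V) 5 <= \sum_x #|neighbours e x|)%N.
    by apply: leq_sum => x _; rewrite ltnNge deg5.
  rewrite sum_nat_const sum_degrees // -/m cardT -cardE -/n n10; lia.
have := triangles_ge_nonneighbours hsimple x; rewrite -s2 => /(_ halpha).
rewrite -/t -/n n10; apply: leq_trans.
(* At least [10 - 5] non-neighbours. *)
have : ('C(5, 3) <= 'C(10 - #|neighbours e x|.+1, 3))%N by apply: leq_bin2l; lia.
rewrite s2; apply: leq_trans; exact: isT.
Qed.
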